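(* Let $R$ be a relative cellular algebra over a field $\mathbb{K}$ with cell datum $(X,M,C,{}^{\star},E,O,\underline{\varepsilon})$, and assume $|X|<\infty$. Then the set $\{[L(\lambda)]\mid\lambda\in X_0\}$ is a complete, non-redundant set of isomorphism classes of simple $R$-modules; that is, each $L(\lambda)$ with $\lambda\in X_0$ is simple, every simple $R$-module is isomorphic to $L(\lambda)$ for some $\lambda\in X_0$, and $L(\lambda)\cong L(\mu)$ with $\lambda,\mu\in X_0$ implies $\lambda=\mu$.
   Context: Conventions: $\mathbb{K}$ is any field; algebras and maps are over $\mathbb{K}$; modules are finite-dimensional left modules unless stated otherwise; idempotents are non-zero. Relative cellular algebra. An associative algebra $R$ together with a (relative) cell datum $(X,M,C,{}^{\star},E,O,\underline{\varepsilon})$ such that: (a) $X$ is a set, $M=\{M(\lambda)\mid\lambda\in X\}$ is a collection of finite non-empty sets, and $C\colon\coprod_{\lambda\in X}M(\lambda)\times M(\lambda)\to R$ is an injective map whose image is a basis of $R$; write $C(S,T)=C^{\lambda}_{S,T}$ for $S,T\in M(\lambda)$. (b) ${}^{\star}\colon R\to R$ is an anti-involution with $(C^{\lambda}_{S,T})^{\star}=C^{\lambda}_{T,S}$. (c) $E$ is a set of pairwise orthogonal idempotents with $\varepsilon^{\star}=\varepsilon$ for all $\varepsilon\in E$; $O=\{<_{\varepsilon}\mid\varepsilon\in E\}$ is a set of partial orders on $X$; and $\underline{\varepsilon}\colon\coprod_{\lambda\in X}M(\lambda)\to E$, $S\mapsto\varepsilon_S$, is a map such that for all $\lambda\in X$,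 $S,T\in M(\lambda)$, $\varepsilon\in E$: $\varepsilon R\varepsilon\, C^{\lambda}_{S,T}\subset R(\leq_{\varepsilon}\lambda)$, and $\varepsilon C^{\lambda}_{S,T}=C^{\lambda}_{S,T}$ if $\varepsilon_S=\varepsilon$, $\varepsilon C^{\lambda}_{S,T}=0$ if $\varepsilon_S\neq\varepsilon$. Here $R(\leq_{\varepsilon}\lambda)=\mathbb{K}\{C^{\mu}_{S,T}\mid\mu\in X,\mu\leq_{\varepsilon}\lambda,S,T\in M(\mu)\}$, and $R(<_{\varepsilon}\lambda)$ is defined in the same way with $<_{\varepsilon}$. (d) For $\lambda\in X$, $S,T\in M(\lambda)$, $a\in R$: $aC^{\lambda}_{S,T}\in\sum_{S'\in M(\lambda)}r_a(S',S)\,C^{\lambda}_{S',T}+R(<_{\varepsilon_T}\lambda)\varepsilon_T$, with scalars $r_a(S',S)\in\mathbb{K}$ depending only on $a,S,S'$. Cell modules. For $\lambda\in X$ the cell module $\Delta(\lambda)$ has basis $\{m^{\lambda}_S\mid S\in M(\lambda)\}$ and action $a\cdot m^{\lambda}_S=\sum_{S'\in M(\lambda)}r_a(S',S)\,m^{\lambda}_{S'}$. The bilinear form $\Phi^{\lambda}$ on $\Delta(\lambda)$ is given by $\Phi^{\lambda}(m^{\lambda}_S,m^{\lambda}_T)=r_{C^{\lambda}_{U,S}}(U,T)$ (independent of $U\in M(\lambda)$), i.e. it is the coefficient of $C^{\lambda}_{U,V}$ in $C^{\lambda}_{U,S}C^{\lambda}_{T,V}$ for any $U,V\in M(\lambda)$.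 Put $\mathrm{rad}(\lambda)=\{x\in\Delta(\lambda)\mid\Phi^{\lambda}(x,y)=0\ \forall y\in\Delta(\lambda)\}$, which is a submodule, $X_0=\{\lambda\in X\mid\Phi^{\lambda}\neq0\}$, and $L(\lambda)=\Delta(\lambda)/\mathrm{rad}(\lambda)$ for $\lambda\in X_0$. *)

(* Defs.v *)
From HB Require Import structures.
From mathcomp Require Import all_boot all_order all_algebra.

Set Implicit Arguments.
Unset Strict Implicit.
Unset Printing Implicit Defensive.

Import GRing.Theory.
Local Open Scope ring_scope.
Local Open Scope quotient_scope.

(* Not assumed unital: the algebra types of MathComp all carry a unit. *)
Record nuAlgebra (K : fieldType) := NuAlgebra {
  alg_car :> lmodType K;
  amul : {bilinear alg_car -> alg_car -> alg_car};
  amulA : associative amul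
}.

Arguments amul {K A} : rename.

Declare Scope alg_scope.
Delimit Scope alg_scope with alg.
Notation "a ** b" := (amul a b) (at level 40, left associativity) : alg_scope.
Local Open Scope alg_scope.

Record amodule (K : fieldType) (A : nuAlgebra K) := AModule {
  mod_car :> vectType K;
  act : {bilinear A -> mod_car -> mod_car};
  actM : forall (a b : A) v, act (a ** b) v = act a (act b v)
}.

Arguments act {K A V} : rename.

Section Modules.
Variables (K : fieldType) (A : nuAlgebra K).
Implicit Types V W : amodule A.

Definition submodule V (U : {vspace V}) : Prop :=
  forall (a : A) (v : V), v \in U -> act a v \in U.

(* The usual notion over a ring without a chosen unit: A V <> 0, and no proper
   nonzero submodule.  If A has a unit acting as the identity on V, then
   A V <> 0 just says V <> 0. *)
Definition simple_module V : Prop :=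
  (exists (a : A) (v : V), act a v != 0) /\
  (forall U : {vspace V}, submodule U -> U = 0%VS \/ U = fullv).

Definition isomorphic_modules V W : Prop :=
  exists f : {linear V -> W}, bijective f /\
    forall (a : A) (v : V), f (act a v) = act a (f v).

End Modules.

Section QuotientSpace.
Variables (K : fieldType) (V : vectType K) (U : {vspace V}).

Definition vquot := Quotient.quot (pred_of_vspace U : zmodClosed V).
HB.instance Definition _ := GRing.Zmodule.on vquot.
HB.instance Definition _ := EqQuotient.on vquot.

Definition vpi (v : V) : vquot := \pi_vquot v.

Lemma vpi_eq (v w : V) : (vpi v == vpi w) = (v - w \in U).
Proof. by rewrite /vpi -Quotient.idealrBE. Qed.

Lemma vpi_repr (q : vquot) : vpi (repr q) = q.
Proof. exact: reprK. Qed.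

Lemma vpiD : {morph vpi : v w / v + w}.
Proof. by move=> v w; rewrite /vpi !piE. Qed.

Definition vquot_scale (k : K) (q : vquot) : vquot := vpi (k *: repr q).

Lemma vpiZ k v : vpi (k *: v) = vquot_scale k (vpi v).
Proof.
by apply/eqP; rewrite vpi_eq -scalerBr memvZ // -vpi_eq vpi_repr.
Qed.

Fact vquot_scaleA a b q :
  vquot_scale a (vquot_scale b q) = vquot_scale (a * b) q.
Proof. by rewrite -[q]vpi_repr -!vpiZ scalerA. Qed.
Fact vquot_scale1 : left_id 1 vquot_scale.
Proof. by move=> q; rewrite -[q]vpi_repr -!vpiZ scale1r. Qed.
Fact vquot_scaleDr : right_distributive vquot_scale +%R.
Proof.
move=> a q p; rewrite -[q]vpi_repr -[p]vpi_repr.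
by rewrite -vpiD -!vpiZ -vpiD scalerDr.
Qed.
Fact vquot_scaleDl q : {morph vquot_scale^~ q : a b / a + b}.
Proof. by move=> a b; rewrite -[q]vpi_repr -!vpiZ -vpiD scalerDl. Qed.

HB.instance Definition _ := GRing.Zmodule_isLmodule.Build K vquot
  vquot_scaleA vquot_scale1 vquot_scaleDr vquot_scaleDl.

Fact vpi_linear : linear vpi.
Proof. by move=> k v w; rewrite vpiD vpiZ. Qed.
HB.instance Definition _ := GRing.isLinear.Build K V vquot _ vpi vpi_linear.

(* Coordinates on V / U: those of the projection onto a complement of U. *)
Let capUC : (U^C :&: U = 0)%VS.
Proof. by rewrite capvC capv_compl. Qed.

Let pr (v : V) : V := daddv_pi (U^C)%VS U v.

Let pr_mod v : v - pr v \in U.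
Proof.
have /(daddv_pi_add capUC) vE : v \in (U^C + U)%VS.
  by rewrite addvC addv_complf memvf.
by rewrite -[X in X - _]vE /pr addrC addKr memv_pi.
Qed.

Let pr_repr v : pr (repr (vpi v)) = pr v.
Proof.
apply/eqP; rewrite -subr_eq0 /pr -linearB /=.
have xU : repr (vpi v) - v \in U by rewrite -vpi_eq vpi_repr.
have : daddv_pi (U^C)%VS U (repr (vpi v) - v) \in (U^C :&: U)%VS.
  rewrite memv_cap memv_pi /= -(subKr (repr (vpi v) - v) (daddv_pi _ _ _)).
  by rewrite memvB // pr_mod.
by rewrite capUC memv0.
Qed.

Fact vquot_vect_iso : Vector.axiom (\dim (U^C)%VS) vquot.
Proof.
exists (fun q => \row_i coord (vbasis (U^C)%VS) i (pr (repr q))).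
  move=> k p q; rewrite -[p]vpi_repr -[q]vpi_repr -linearP !pr_repr.
  by apply/rowP=> i; rewrite !mxE /pr !linearP.
exists (fun r : 'rV_(\dim (U^C)%VS) =>
    vpi (\sum_i r 0 i *: (vbasis (U^C)%VS)`_i)) => [q|r].
  rewrite -[q in RHS]vpi_repr; apply/eqP; rewrite eq_sym vpi_eq.
  rewrite (eq_bigr (fun i => coord (vbasis (U^C)%VS) i (pr (repr q)) *:
      (vbasis (U^C)%VS)`_i)) => [|i _]; last by rewrite mxE.
  by rewrite -coord_vbasis ?pr_mod // memv_pi.
apply/rowP=> i; rewrite mxE pr_repr /pr daddv_pi_id //; last first.
  by rewrite memv_suml // => j _; rewrite memvZ // vbasis_mem // mem_nth ?size_tuple.
by rewrite coord_sum_free // (basis_free (vbasisP _)).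
Qed.
HB.instance Definition _ := Lmodule_hasFinDim.Build K vquot vquot_vect_iso.

End QuotientSpace.

Section QuotientModule.
Variables (K : fieldType) (A : nuAlgebra K) (V : amodule A) (U : {vspace V}).
Hypothesis subU : submodule U.

Definition quot_act (a : A) (q : vquot U) : vquot U := vpi U (act a (repr q)).

Lemma quot_act_vpi a v : quot_act a (vpi U v) = vpi U (act a v).
Proof.
by apply/eqP; rewrite vpi_eq -linearBr subU // -vpi_eq vpi_repr.
Qed.

Fact quot_act_bilinear : bilinear_for *:%R *:%R quot_act.
Proof.
split=> [q | a] k x y.
  by rewrite -[q]vpi_repr !quot_act_vpi linearPl linearP.
by rewrite -[x]vpi_repr -[y]vpi_repr -linearP !quot_act_vpi linearPr linearP.
Qed.

Definition quot_act_bil : {bilinear A -> vquot U -> vquot U} :=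
  HB.pack quot_act
    (bilinear_isBilinear.Build K A (vquot U) (vquot U) *:%R *:%R quot_act
       quot_act_bilinear).

Fact quot_actM (a b : A) (q : vquot U) :
  quot_act_bil (a ** b) q = quot_act_bil a (quot_act_bil b q).
Proof.
by rewrite /= -[q]vpi_repr !quot_act_vpi actM.
Qed.

Definition quot_module : amodule A := AModule quot_actM.

End QuotientModule.

Section Span.
Variables (K : fieldType) (V : lmodType K).

Definition in_span (P : V -> Prop) (v : V) : Prop :=
  exists s : seq (K * V),
    (forall p, p \in s -> P p.2) /\ v = \sum_(p <- s) p.1 *: p.2.

(* Freeness is that of the family b, which makes b injective. *)
Definition is_basis (I : eqType) (b : I -> V) : Prop :=
  (forall (s : seq I) (c : I -> K), uniq s ->
     \sum_(i <- s) c i *: b i = 0 -> {in s, forall i, c i = 0}) /\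
  (forall v, in_span (fun w => exists i, w = b i) v).

End Span.

Section LowerSpan.
Variables (K : fieldType) (A : nuAlgebra K) (X : eqType) (M : X -> finType).
Variable C : forall l : X, M l -> M l -> A.

Definition cell_index : eqType := {l : X & (M l * M l)%type}.
Definition cell_elt (i : cell_index) : A := C (tagged i).1 (tagged i).2.

Definition cell_span (Y : pred X) : A -> Prop :=
  in_span (fun w => exists m (S T : M m), Y m /\ w = C S T).

End LowerSpan.

(* The set E and the orders O are families indexed by the type cd_E; since the
   idempotents are nonzero and orthogonal, cd_idem is injective.
   The scalars cd_r are determined by the rest of the datum: see coef_mulC. *)
Record cell_datum (K : fieldType) (A : nuAlgebra K) (X : eqType) := CellDatum {
  cd_M : X -> finType;
  cd_M_nonempty : forall l, (0 < #|cd_M l|)%N;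
  cd_C : forall l, cd_M l -> cd_M l -> A;
  cd_basis : is_basis (cell_elt cd_C);

  cd_star : {linear A -> A};
  cd_starK : involutive cd_star;
  cd_starM : forall a b : A, cd_star (a ** b) = cd_star b ** cd_star a;
  cd_starC : forall l (S T : cd_M l), cd_star (cd_C S T) = cd_C T S;

  cd_E : eqType;
  cd_idem : cd_E -> A;
  cd_idem_neq0 : forall e, cd_idem e != 0;
  cd_idemM : forall e, cd_idem e ** cd_idem e = cd_idem e;
  cd_idem_orth : forall e f, e != f -> cd_idem e ** cd_idem f = 0;
  cd_idem_star : forall e, cd_star (cd_idem e) = cd_idem e;

  cd_le : cd_E -> rel X;
  cd_le_refl : forall e, reflexive (cd_le e);
  cd_le_anti : forall e, antisymmetric (cd_le e);
  cd_le_trans : forall e, transitive (cd_le e);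

  cd_eps : forall l, cd_M l -> cd_E;
  cd_corner : forall (l : X) (S T : cd_M l) (e : cd_E) (a : A),
    cell_span cd_C (fun m => cd_le e m l)
      (cd_idem e ** a ** cd_idem e ** cd_C S T);
  cd_idemC : forall (l : X) (S T : cd_M l) (e : cd_E),
    cd_idem e ** cd_C S T = if cd_eps S == e then cd_C S T else 0;

  cd_r : forall l : X, A -> cd_M l -> cd_M l -> K;
  cd_mulC : forall (l : X) (S T : cd_M l) (a : A),
    exists2 y : A,
      cell_span cd_C (fun m => (m != l) && cd_le (cd_eps T) m l) y &
      a ** cd_C S T = \sum_(S' : cd_M l) cd_r a S' S *: cd_C S' T
                      + y ** cd_idem (cd_eps T)
}.

Section CellTheory.
Variables (K : fieldType) (A : nuAlgebra K) (X : eqType) (D : cell_datum A X).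

Local Notation M := (cd_M D).
Local Notation C := (@cd_C _ _ _ D _).
Local Notation idem := (cd_idem (c := D)).
Local Notation r := (@cd_r _ _ _ D _).
Local Notation elt := (cell_elt (@cd_C _ _ _ D)).
Local Notation span := (cell_span (@cd_C _ _ _ D)).
Local Notation I := (cell_index M).
Local Notation lt e l := (fun m => (m != l) && @cd_le _ _ _ D e m l).

Definition cell_idx (l : X) (S T : M l) : I :=
  Tagged (fun l => (M l * M l)%type) (S, T).

Let has_coefs (x : A) (c : I -> K) : Prop :=
  exists u0 : seq I, (forall i, i \notin u0 -> c i = 0) /\
    forall u, uniq u -> {subset u0 <= u} -> x = \sum_(i <- u) c i *: elt i.

(* k is the coefficient of the basis element of index i in x. *)
Definition is_coef (x : A) (i : I) (k : K) : Prop :=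
  exists2 c, has_coefs x c & c i = k.

Let has_coefs0 : has_coefs 0 (fun=> 0).
Proof. by exists [::]; split=> // u _ _; rewrite big1 // => i _; rewrite scale0r. Qed.

Let has_coefs_lin k x y c d : has_coefs x c -> has_coefs y d ->
  has_coefs (k *: x + y) (fun i => k * c i + d i).
Proof.
move=> [u [u0 uE]] [v [v0 vE]]; exists (u ++ v); split=> [i|w w1 sw].
  by rewrite mem_cat negb_or => /andP[/u0 -> /v0 ->]; rewrite mulr0 addr0.
have suw : {subset u <= w} by move=> i iu; apply: sw; rewrite mem_cat iu.
have svw : {subset v <= w} by move=> i iv; apply: sw; rewrite mem_cat iv orbT.
rewrite (uE w) // (vE w) // scaler_sumr -big_split /=; apply: eq_bigr => i _.
by rewrite scalerDl scalerA.
Qed.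

Let has_coefs_elt j : has_coefs (elt j) (fun i => (i == j)%:R).
Proof.
exists [:: j]; split=> [i|u uu su]; first by rewrite inE => /negPf ->.
rewrite (bigD1_seq j) //=; last by apply: su; rewrite inE.
rewrite eqxx scale1r big1 ?addr0 // => i /negPf ->.
by rewrite scale0r.
Qed.

Let has_coefs_uniq x c d : has_coefs x c -> has_coefs x d -> c =1 d.
Proof.
move=> [u [u0 uE]] [v [v0 vE]] i.
pose w := undup (i :: u ++ v).
have iw : i \in w by rewrite mem_undup inE eqxx.
have uw : uniq w by apply: undup_uniq.
have [free _] := cd_basis D.
have := free w (fun i => c i - d i) uw; rewrite -[RHS]subr0 => H.
apply/eqP; rewrite -subr_eq0; apply/eqP; apply: H iw.
under eq_bigr do rewrite scalerBl.
rewrite sumrB -(uE w) // => [|j ju]; last first.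
  by rewrite mem_undup inE mem_cat ju orbT.
rewrite -(vE w) ?subrr // => j jv.
by rewrite mem_undup inE mem_cat jv !orbT.
Qed.

Let has_coefs_span (Y : pred X) x : span Y x ->
  exists2 c, has_coefs x c & forall i, ~~ Y (tag i) -> c i = 0.
Proof.
move=> [s [sP ->]]; elim: s sP => [|[k w] s IH] sP.
  by exists (fun=> 0) => //; rewrite big_nil.
have [|c cs c0] := IH; first by move=> p ps; apply: sP; rewrite inE ps orbT.
have [m [S [T [Ym /= ->]]]] := sP (k, w) (mem_head _ _).
exists (fun i => k * (i == cell_idx S T)%:R + c i).
  by rewrite big_cons; apply: has_coefs_lin cs; apply: (has_coefs_elt (cell_idx S T)).
move=> i Yi; rewrite c0 // addr0; case: eqP => [ii|]; last by rewrite mulr0.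
by rewrite ii Ym in Yi.
Qed.

Lemma spanT x : span predT x.
Proof.
have [_ /(_ x)[s [sP ->]]] := cd_basis D.
exists s; split=> // p /sP[[m [S T]] ->].
by exists m, S, T.
Qed.

Lemma coef_ex x i : exists k, is_coef x i k.
Proof. by have [c cx _] := has_coefs_span (spanT x); exists (c i), c. Qed.

Lemma coef_uniq x i k l : is_coef x i k -> is_coef x i l -> k = l.
Proof. by move=> [c cx <-] [d dx <-]; apply: has_coefs_uniq cx dx i. Qed.

Lemma coef_lin a x y i k l : is_coef x i k -> is_coef y i l ->
  is_coef (a *: x + y) i (a * k + l).
Proof. by move=> [c cx <-] [d dx <-]; exists (fun i => a * c i + d i) => //; apply: has_coefs_lin. Qed.

Lemma coef0 i : is_coef 0 i 0.
Proof. by exists (fun=> 0). Qed.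

Lemma coefD x y i k l : is_coef x i k -> is_coef y i l ->
  is_coef (x + y) i (k + l).
Proof. by move=> cx cy; have := coef_lin 1 cx cy; rewrite scale1r mul1r. Qed.

Lemma coefZ a x i k : is_coef x i k -> is_coef (a *: x) i (a * k).
Proof. by move=> cx; have := coef_lin a cx (coef0 i); rewrite !addr0. Qed.

Lemma coef_sum (J : Type) (s : seq J) (f : J -> A) (g : J -> K) i :
  (forall j, is_coef (f j) i (g j)) ->
  is_coef (\sum_(j <- s) f j) i (\sum_(j <- s) g j).
Proof.
move=> H; elim: s => [|j s IH]; first by rewrite !big_nil; apply: coef0.
by rewrite !big_cons; apply: coefD.
Qed.

Lemma coefC (l : X) (S T : M l) i : is_coef (C S T) i (i == cell_idx S T)%:R.
Proof. by exists (fun i => (i == cell_idx S T)%:R) => //; apply: (has_coefs_elt (cell_idx S T)). Qed.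

Lemma coef_span (Y : pred X) x i : span Y x -> ~~ Y (tag i) -> is_coef x i 0.
Proof. by move=> /has_coefs_span[c cx c0] /c0; exists c. Qed.

Lemma coef_star l (S T : M l) x k :
  is_coef x (cell_idx S T) k -> is_coef (cd_star D x) (cell_idx T S) k.
Proof.
pose sw (i : I) : I := cell_idx (tagged i).2 (tagged i).1.
have swK : involutive sw by case=> m [U V].
move=> [c [u [u0 uE]] <-]; exists (c \o sw) => //.
exists (map sw u); split=> [i|v uv sv] /=.
  move=> iu; apply: u0; apply: contra iu => iu.
  by apply/mapP; exists (sw i).
rewrite (uE (map sw v)).
- rewrite big_map linear_sum; apply: eq_bigr => i _.
  by rewrite linearZ /= cd_starC.
- by rewrite map_inj_uniq //; apply: can_inj swK.
move=> i iu; apply/mapP; exists (sw i) => //.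
by apply: sv; apply: map_f.
Qed.

Lemma span_lin Y k x y : span Y x -> span Y y -> span Y (k *: x + y).
Proof.
move=> [s [sP ->]] [t [tP ->]].
exists ([seq (k * p.1, p.2) | p <- s] ++ t); split=> [p|].
  by rewrite mem_cat => /orP[/mapP[q /sP qP ->]|/tP].
rewrite big_cat big_map scaler_sumr; congr (_ + _); apply: eq_bigr => p _.
by rewrite scalerA.
Qed.

Lemma span0 Y : span Y 0.
Proof. by exists [::]; rewrite big_nil. Qed.

Lemma spanD Y x y : span Y x -> span Y y -> span Y (x + y).
Proof. by move=> sx sy; have := span_lin 1 sx sy; rewrite scale1r. Qed.

Lemma spanZ Y k x : span Y x -> span Y (k *: x).
Proof. by move=> sx; have := span_lin k sx (span0 Y); rewrite addr0. Qed.

Lemma span_sum Y (J : Type) (s : seq J) (f : J -> A) :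
  (forall j, span Y (f j)) -> span Y (\sum_(j <- s) f j).
Proof.
move=> H; elim: s => [|j s IH]; first by rewrite big_nil; apply: span0.
by rewrite big_cons; apply: spanD.
Qed.

Lemma spanC (Y : pred X) m (S T : M m) : Y m -> span Y (C S T).
Proof.
move=> Ym; exists [:: (1, C S T)]; rewrite big_seq1 scale1r; split=> // p.
by rewrite inE => /eqP ->; exists m, S, T.
Qed.

Lemma span_map (Y Z : pred X) (f : A -> A) : linear f ->
  (forall m (S T : M m), Y m -> span Z (f (C S T))) ->
  forall x, span Y x -> span Z (f x).
Proof.
move=> fL H x [s [sP ->]]; elim: s sP => [|p s IH] sP.
  rewrite big_nil; have := fL (-1) 0 0.
  by rewrite scaler0 addr0 scaleN1r addNr => ->; apply: span0.
rewrite big_cons fL; apply: span_lin; last first.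
  by apply: IH => q qs; apply: sP; rewrite inE qs orbT.
by have [m [S [T [Ym ->]]]] := sP p (mem_head _ _); apply: H.
Qed.

Lemma span_sub (Y Z : pred X) x : subpred Y Z -> span Y x -> span Z x.
Proof.
move=> YZ; apply: (span_map (f := id)) => // m S T /YZ; exact: spanC.
Qed.

Lemma mulC_idem l (S T : M l) e :
  C S T ** idem e = if cd_eps T == e then C S T else 0.
Proof.
rewrite -[LHS](cd_starK D) cd_starM cd_starC cd_idem_star cd_idemC.
by case: ifP => _; rewrite ?cd_starC ?linear0.
Qed.

Lemma span_idem Y e x : span Y x -> span Y (x ** idem e).
Proof.
apply: (span_map (f := fun x => x ** idem e)) => [k y z|m S T Ym].
  by rewrite linearPl.
by rewrite mulC_idem; case: ifP => _; [apply: spanC | apply: span0].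
Qed.

Lemma lt_trans e l m n : lt e l m -> lt e m n -> lt e l n.
Proof.
move=> /andP[ml lml] /andP[nm lnm]; rewrite (cd_le_trans lnm lml) andbT.
apply: contraNneq ml => nl; rewrite nl in lnm; apply/eqP.
by apply: (@cd_le_anti _ _ _ D e); rewrite lml lnm.
Qed.

Lemma span_ideal e l a x : span (lt e l) x -> span (lt e l) (a ** (x ** idem e)).
Proof.
apply: (span_map (f := fun x => a ** (x ** idem e))) => [k y z|m S T Ym].
  by rewrite linearPl linearPr.
rewrite mulC_idem; case: eqP => [eT|_]; last by rewrite linear0r; apply: span0.
have [y ylt ->] := cd_mulC S T a.
apply: spanD; first by apply: span_sum => S'; apply: spanZ; apply: spanC.
apply: span_idem; rewrite eT in ylt.
by apply: span_sub ylt => n; apply: lt_trans.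
Qed.

Lemma coef_mulC l (S S' T : M l) a : is_coef (a ** C S T) (cell_idx S' T) (r a S' S).
Proof.
have [y ylt ->] := cd_mulC S T a.
rewrite -[r a S' S]addr0; apply: coefD; last first.
  by apply: coef_span (span_idem _ ylt) _; rewrite /= eqxx.
have -> : r a S' S = \sum_(U : M l) r a U S * (cell_idx S' T == cell_idx U T)%:R.
  rewrite (bigD1 S') //= eqxx mulr1 big1 ?addr0 // => U US'.
  case: eqP => [/eqP|]; last by rewrite mulr0.
  rewrite eq_Tagged /= => /eqP[eU]; by rewrite eU eqxx in US'.
by apply: coef_sum => U; apply: coefZ; apply: coefC.
Qed.

Let pt l : M l := enum_val (Ordinal (cd_M_nonempty D l)).

Lemma cd_r_lin l k a b (S' S : M l) : r (k *: a + b) S' S = k * r a S' S + r b S' S.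
Proof.
apply: coef_uniq (coef_mulC S S' (pt l) _) _.
by rewrite linearPl; apply: coef_lin; apply: coef_mulC.
Qed.

Lemma cd_rM l a b (S' S : M l) : r (a ** b) S' S = \sum_U r a S' U * r b U S.
Proof.
pose T := pt l; apply: coef_uniq (coef_mulC S S' T _) _.
rewrite -amulA; have [y ylt ->] := cd_mulC S T b.
rewrite linearDr linear_sumr -[X in is_coef _ _ X]addr0; apply: coefD.
  apply: coef_sum => U; rewrite mulrC linearZr_LR.
  by apply: coefZ; apply: coef_mulC.
by apply: coef_span (span_ideal _ ylt) _; rewrite /= eqxx.
Qed.

(* C_{U,S} C_{T,V} computed modulo lower terms from either factor. *)
Lemma cd_r_swap l (S T U V : M l) : r (C U S) U T = r (C V T) V S.
Proof.
apply: coef_uniq (coef_mulC T U V _) _.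
rewrite -(cd_starK D (C U S ** _)); apply: coef_star.
by rewrite cd_starM !cd_starC; apply: coef_mulC.
Qed.

Definition gram (l : X) (S T : M l) : K := r (C S S) S T.

(* The defining coefficient does not depend on the auxiliary indices. *)
Lemma gramE l (U S T : M l) : gram S T = r (C U S) U T.
Proof. by rewrite /gram (cd_r_swap S T S U) (cd_r_swap T S U U). Qed.

Lemma gram_coef l (S T U V : M l) :
  is_coef (C U S ** C T V) (cell_idx U V) (gram S T).
Proof. by rewrite (gramE U); apply: coef_mulC. Qed.

Lemma gram_star l a (S T : M l) :
  \sum_T' r a T' T * gram S T' = \sum_S' r (cd_star D a) S' S * gram S' T.
Proof.
have gC (U V : M l) : gram U V = gram V U by rewrite (gramE V) (cd_r_swap U V V V).
transitivity (r (C S S ** a) S T).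
  by rewrite cd_rM; apply: eq_bigr => T' _; rewrite mulrC.
transitivity (r (C T T ** cd_star D a) T S); last first.
  by rewrite cd_rM; apply: eq_bigr => S' _; rewrite mulrC gC.
apply: coef_uniq (coef_mulC T S T _) _.
rewrite -(cd_starK D (C S S ** a ** _)); apply: coef_star.
rewrite !cd_starM !cd_starC amulA; exact: coef_mulC.
Qed.

Section CellModule.
Variable l : X.

(* Functions M l -> K; the basis vector m_S is the indicator of S. *)
Definition cell_space : vectType K := {ffun M l -> K^o}.
Definition cell_vec (S : M l) : cell_space := [ffun S' => (S' == S)%:R].

Definition cell_act (a : A) (x : cell_space) : cell_space :=
  [ffun S' => \sum_S r a S' S * x S].

Fact cell_act_bilinear : bilinear_for *:%R *:%R cell_act.
Proof.
split=> [x | a] k y z; apply/ffunP=> S'; rewrite !ffunE scaler_sumr -big_split /=;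
  apply: eq_bigr => S _.
  by rewrite cd_r_lin mulrDl -mulrA.
by rewrite !ffunE mulrDr mulrCA.
Qed.

Definition cell_act_bil : {bilinear A -> cell_space -> cell_space} :=
  HB.pack cell_act
    (bilinear_isBilinear.Build K A cell_space cell_space *:%R *:%R cell_act
       cell_act_bilinear).

Fact cell_actM (a b : A) (x : cell_space) :
  cell_act_bil (a ** b) x = cell_act_bil a (cell_act_bil b x).
Proof.
apply/ffunP=> S'; rewrite !ffunE.
under eq_bigr do rewrite cd_rM mulr_suml.
rewrite exchange_big; apply: eq_bigr => U _.
by rewrite ffunE mulr_sumr; apply: eq_bigr => S _; rewrite mulrA.
Qed.

Definition cell_module : amodule A := AModule cell_actM.

Lemma cell_act_vec a S :
  cell_act a (cell_vec S) = \sum_S' r a S' S *: cell_vec S'.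
Proof.
apply/ffunP=> U; rewrite ffunE sum_ffunE (bigD1 S) //= [RHS](bigD1 U) //=.
rewrite !ffunE !eqxx [X in _ + X = _]big1 => [|V VS]; last first.
  by rewrite ffunE (negPf VS) mulr0.
rewrite [X in _ = _ + X]big1 // => V VU.
by rewrite !ffunE eq_sym (negPf VU) scaler0.
Qed.

Definition cell_form (x y : cell_space) : K :=
  \sum_S \sum_T x S * y T * gram S T.

Lemma cell_form_vec S T : cell_form (cell_vec S) (cell_vec T) = gram S T.
Proof.
rewrite /cell_form (bigD1 S) //= (bigD1 T) //= !ffunE !eqxx !mul1r.
rewrite big1 ?big1 ?addr0 // => [U US|U UT].
  by rewrite big1 // => V _; rewrite ffunE (negPf US) !mul0r.
by rewrite !ffunE (negPf UT) mulr0 mul0r.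
Qed.

Fact cell_form_bilinear : bilinear_for *%R *%R cell_form.
Proof.
split=> [y | x] k u v; rewrite /cell_form /= mulr_sumr -big_split /=;
  apply: eq_bigr => S _; rewrite mulr_sumr -big_split /=;
  apply: eq_bigr => T _; rewrite !ffunE /GRing.scale /=.
  by rewrite !mulrDl -!mulrA.
by rewrite mulrDr mulrDl (mulrCA _ k) -!mulrA.
Qed.

Definition cell_form_bil : {biscalar cell_space} :=
  HB.pack cell_form
    (bilinear_isBilinear.Build K cell_space cell_space K *%R *%R cell_form
       cell_form_bilinear).

Lemma cell_form_act a x y :
  cell_form x (cell_act a y) = cell_form (cell_act (cd_star D a) x) y.
Proof.
transitivity (\sum_S \sum_T x S * y T * \sum_T' r a T' T * gram S T').
  apply: eq_bigr => S _.
  under eq_bigr do rewrite ffunE mulr_sumr mulr_suml.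
  rewrite exchange_big /=; apply: eq_bigr => T _.
  rewrite mulr_sumr; apply: eq_bigr => T' _.
  by rewrite (mulrC (r _ _ _)) !mulrA.
under eq_bigr do under eq_bigr do rewrite gram_star.
transitivity (\sum_S \sum_S' \sum_T
    r (cd_star D a) S' S * x S * y T * gram S' T).
  apply: eq_bigr => S _; rewrite exchange_big /=; apply: eq_bigr => T _.
  rewrite mulr_sumr; apply: eq_bigr => S' _.
  by rewrite -!mulrA (mulrCA (y T)) (mulrCA (x S)).
rewrite exchange_big /=; apply: eq_bigr => S' _.
rewrite exchange_big /=; apply: eq_bigr => T _.
by rewrite ffunE !mulr_suml.
Qed.

Definition cell_form_map (x : cell_space) : cell_space := [ffun T => cell_form x (cell_vec T)].
Fact cell_form_map_linear : linear cell_form_map.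
Proof.
move=> k x y; apply/ffunP=> T; rewrite !ffunE.
exact: (linearPl cell_form_bil).
Qed.

(* rad(l), as the kernel of the map x |-> (T |-> Phi(x, m_T)); see cell_radP. *)
Definition cell_rad : {vspace cell_space} :=
  lker (linfun (HB.pack cell_form_map
    (GRing.isLinear.Build K cell_space cell_space _ cell_form_map
       cell_form_map_linear)
      : {linear cell_space -> cell_space})).

Lemma cell_vec_sum (x : cell_space) : x = \sum_S x S *: cell_vec S.
Proof.
apply/ffunP=> T; rewrite sum_ffunE (bigD1 T) //= big1 => [|S ST].
  by rewrite !ffunE eqxx addr0 /GRing.scale /= mulr1.
by rewrite !ffunE eq_sym (negPf ST) scaler0.
Qed.

Lemma cell_radP (x : cell_space) :
  reflect (forall y, cell_form x y = 0) (x \in cell_rad).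
Proof.
apply: (iffP idP) => [|x0]; rewrite memv_ker lfunE /=; last first.
  by apply/eqP/ffunP=> T; rewrite !ffunE x0.
move=> /eqP/ffunP x0 y; rewrite (cell_vec_sum y).
rewrite -[LHS]/(cell_form_bil x _) linear_sumr big1 // => T _.
rewrite linearZr_LR /=.
by have := x0 T; rewrite !ffunE => ->; rewrite mulr0.
Qed.

Lemma cell_rad_submodule : submodule (cell_rad : {vspace cell_module}).
Proof.
move=> a x /cell_radP x0; apply/cell_radP => y /=.
by rewrite -(cd_starK D a) -cell_form_act x0.
Qed.

(* L(l), meaningful when l lies in X_0; otherwise this is the zero module. *)
Definition cell_head : amodule A := quot_module cell_rad_submodule.

(* l lies in X_0. *)
Definition cell_form_nonzero : Prop := exists x y, cell_form x y != 0.

End CellModule.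
End CellTheory.

(* Main.v *)
Require Import Defs.
From HB Require Import structures.
From mathcomp Require Import all_boot all_order all_algebra.

(** On [Delta(l)] the element [C U S] acts as the rank one map
    [x |-> Phi(m_S, x) m_U], so every submodule not contained in [rad(l)] is
    everything; hence [L(l)] is simple when [Phi <> 0].
    Given a simple [V] and [v] in [V], let [l] be minimal for [<=_e] among the
    cells with some [C S T] such that [e = eps T] and [C S T v <> 0].  Then
    [R(<_e l) e] kills [v], so [m_S |-> C S T v] is a nonzero homomorphism
    [Delta(l) -> V].
    It is onto; writing [v] itself as an image shows [Phi <> 0], and then the
    kernel is [rad(l)].
    Finally, suppose [L(l)] and [L(m)] are isomorphic and [Phi^l(m_S, m_T) <> 0].
    As [C S T] does not kill [L(m)], [m <=_e l] for [e = eps S]; as [e] does not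
    kill [L(m)] either, [m] also has a pair with nonzero form starting in [e],
    so that [l <=_e m] for the same order. *)

Set Implicit Arguments.
Unset Strict Implicit.
Unset Printing Implicit Defensive.

(* Re-imported because poly.v shadows coefC, coefD, coefZ and coef_sum. *)
Import Defs.
Import GRing.Theory.
Local Open Scope ring_scope.
Local Open Scope alg_scope.

(** * Simple quotients and isomorphisms of modules *)

Section ModuleLemmas.
Variables (K : fieldType) (A : nuAlgebra K).

(** Submodules of the quotient are pulled back to [V]: a pullback inside [U] comes from 0, any other
    is all of [V]. *)
Lemma simple_quot_module (V : amodule A) (U : {vspace V}) (sU : submodule U) :
  (exists a (v : V), act a v \notin U) ->
  (forall W : {vspace V}, submodule W -> ~~ (W <= U)%VS -> W = fullv) ->
  simple_module (quot_module sU).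
Proof.
move=> [a [v avU]] maxU; split=> [|W sW].
  exists a, (vpi U v); rewrite /= (quot_act_vpi sU).
  by rewrite -(linear0 (vpi U)) vpi_eq subr0.
pose p := linfun (vpi U); pose W' := (p @^-1: W)%VS.
have W'E x : (x \in W') = (vpi U x \in W) by rewrite -memv_preim lfunE.
have sW' : submodule W'.
  move=> b x; rewrite !W'E => /(sW b).
  by rewrite /= (quot_act_vpi sU).
case/boolP: (W' <= U)%VS => [/subvP W'U|/(maxU _ sW') W'f]; [left|right].
  apply/eqP; rewrite -subv0; apply/subvP=> q.
  rewrite -[q]vpi_repr -W'E => /W'U; rewrite memv0.
  by rewrite -(linear0 (vpi U)) vpi_eq subr0.
apply/eqP; rewrite eqEsubv subvf; apply/subvP=> q _.
by rewrite -[q]vpi_repr -W'E W'f memvf.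
Qed.

(** The map sends [v] to the class of a preimage under [f]; as [lker f = U], the class does not
    depend on the preimage, which makes the map equivariant. *)
Lemma hom_quot_isomorphic (V W : amodule A) (f : 'Hom(W, V))
    (U : {vspace W}) (sU : submodule U) :
  (forall a w, f (act a w) = act a (f w)) -> limg f = fullv -> lker f = U ->
  isomorphic_modules V (quot_module sU).
Proof.
move=> fM fim fker.
have fK v : f ((f^-1)%VF v) = v by rewrite limg_lfunVK // fim memvf.
pose g : V -> vquot U := vpi U \o (f^-1)%VF.
have gE x y : (vpi U x == vpi U y) = (f x == f y).
  by rewrite vpi_eq -fker memv_ker linearB subr_eq0.
exists (g : {linear V -> vquot U}); split=> [|a v]; last first.
  by apply/eqP; rewrite /= (quot_act_vpi sU) gE fM !fK.
exists (fun q : vquot U => f (repr q)) => [v|q] /=.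
  by apply/eqP; rewrite -[v in _ == v]fK -gE vpi_repr.
by rewrite -[q in RHS]vpi_repr; apply/eqP; rewrite gE fK.
Qed.

(** Whether [a] acts as zero is the invariant that later separates the heads. *)
Lemma isomorphic_act_neq0 (V W : amodule A) (a : A) : isomorphic_modules V W ->
  (exists v : V, act a v != 0) <-> (exists w : W, act a w != 0).
Proof.
move=> [f [fbij fM]]; have fI := bij_inj fbij; have [g fK gK] := fbij.
split=> [[v av]|[w aw]].
  by exists (f v); rewrite -fM -(linear0 f) (inj_eq fI).
by exists (g w); rewrite -(inj_eq fI) fM gK linear0.
Qed.

Lemma isomorphic_modules_sym (V W : amodule A) :
  isomorphic_modules V W -> isomorphic_modules W V.
Proof.
move=> [f [[g fK gK] fM]].
have gL : linear g by apply: can2_linear fK gK.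
exists (HB.pack g (GRing.isLinear.Build K W V _ g gL) : {linear W -> V}).
split=> [|a w]; first by exists f.
by apply: (can_inj fK); rewrite /= fM !gK.
Qed.

End ModuleLemmas.

(** * The action on cell modules and the radical *)

Section CellModules.
Variables (K : fieldType) (A : nuAlgebra K) (X : eqType) (D : cell_datum A X).

Local Notation M := (cd_M D).
Local Notation C := (@cd_C _ _ _ D _).
Local Notation idem := (cd_idem (c := D)).
Local Notation r := (@cd_r _ _ _ D _).
Local Notation le := (@cd_le _ _ _ D).
Local Notation span := (cell_span (@cd_C _ _ _ D)).
Local Notation lt e l := (fun m => (m != l) && le e m l).

Lemma gramC l (S T : M l) : gram S T = gram T S.
Proof. by rewrite (gramE T) (cd_r_swap S T T T). Qed.

(** For [S' <> U], apply the involution: in [C T T ** C S U] all terms of level [l] keep the right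
    index [U], so [C T S'] does not occur. *)
Lemma cd_r_cell l (U S T S' : M l) :
  r (C U S) S' T = (S' == U)%:R * gram S T.
Proof.
case: eqP => [->|/eqP neU]; first by rewrite mul1r -gramE.
rewrite mul0r; apply: coef_uniq (coef_mulC T S' T _) _.
rewrite -(cd_starK D (C U S ** _)); apply: coef_star.
rewrite cd_starM !cd_starC; have [y ylt ->] := cd_mulC S U (C T T).
have y0 : is_coef (y ** idem (cd_eps U)) (cell_idx T S') 0.
  by apply: coef_span (span_idem _ ylt) _; rewrite /= eqxx.
have := coefD (coef_sum (index_enum (M l)) (fun V =>
  coefZ (r (C T T) V S) (coefC V U (cell_idx T S')))) y0.
rewrite addr0 [X in is_coef _ _ X]big1 // => V _.
by rewrite eq_Tagged /= xpair_eqE (negPf neU) andbF mulr0.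
Qed.

Lemma cell_form_vecl l (S : M l) y :
  cell_form (cell_vec S) y = \sum_T y T * gram S T.
Proof.
rewrite {1}(cell_vec_sum y) -[LHS]/(cell_form_bil D l _ _) linear_sumr.
by apply: eq_bigr => T _; rewrite linearZr_LR /= cell_form_vec.
Qed.

Lemma cell_act_cell l (U S : M l) x :
  cell_act (C U S) x = cell_form (cell_vec S) x *: cell_vec U.
Proof.
apply/ffunP=> S'; rewrite !ffunE cell_form_vecl /GRing.scale /= mulr_suml.
apply: eq_bigr => T _.
by rewrite cd_r_cell mulrC -mulrA (mulrC (gram _ _)) mulrA mulrAC.
Qed.

Lemma cell_act_idem e l (P : M l) :
  cell_act (idem e) (cell_vec P) = if cd_eps P == e then cell_vec P else 0.
Proof.
have rE S : r (idem e) S P = (cd_eps P == e)%:R * (S == P)%:R.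
  apply: coef_uniq (coef_mulC P S P _) _; rewrite cd_idemC.
  case: ifP => _; last by rewrite mul0r; apply: coef0.
  rewrite mul1r; have := coefC P P (cell_idx S P).
  by rewrite eq_Tagged /= xpair_eqE eqxx andbT.
rewrite cell_act_vec (bigD1 P) //= rE eqxx mulr1 big1 ?addr0 => [|S /negPf SP].
  by case: ifP => _; rewrite ?scale1r ?scale0r.
by rewrite rE SP mulr0 scale0r.
Qed.

Lemma cell_formC l (x y : cell_space D l) : cell_form x y = cell_form y x.
Proof.
rewrite /cell_form exchange_big; apply: eq_bigr => T _; apply: eq_bigr => S _.
by rewrite gramC (mulrC (x S)).
Qed.

Lemma cell_radPn l (x : cell_space D l) :
  reflect (exists S : M l, cell_form (cell_vec S) x != 0) (x \notin cell_rad D l).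
Proof.
apply: (iffP idP) => [xrad|[S]]; last first.
  by apply: contraNN => /cell_radP x0; rewrite cell_formC x0.
apply/existsP; apply: contraR xrad => /existsPn x0.
apply/cell_radP=> y; rewrite cell_formC (cell_vec_sum y).
rewrite -[LHS]/(cell_form_bil D l _ _) linear_sumlz big1 // => S _.
by rewrite linearZl_LR /=; have /negPn/eqP -> := x0 S; rewrite mulr0.
Qed.

Lemma cell_submodule_full l (W : {vspace cell_space D l}) :
  submodule (W : {vspace cell_module D l}) -> ~~ (W <= cell_rad D l)%VS ->
  W = fullv.
Proof.
move=> sW /subvPn[x xW /cell_radPn[S Sx]].
apply/eqP; rewrite eqEsubv subvf; apply/subvP=> y _.
rewrite (cell_vec_sum y); apply: memv_suml => U _; apply: memvZ.
have := sW (C U S) x xW.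
by rewrite /= cell_act_cell rpredZeq (negPf Sx).
Qed.

Lemma cell_form_nonzeroP l :
  cell_form_nonzero D l <-> exists S T : M l, gram S T != 0.
Proof.
split=> [[x [y xy]]|[S [T ST]]]; last first.
  by exists (cell_vec S), (cell_vec T); rewrite cell_form_vec.
have /cell_radPn[S Sy] : y \notin cell_rad D l.
  by apply: contraNN xy => /cell_radP y0; rewrite cell_formC y0.
have /cell_radPn[T TS] : cell_vec S \notin cell_rad D l.
  by apply: contraNN Sy => /cell_radP ->.
by exists T, S; rewrite -cell_form_vec.
Qed.

(** * Simplicity of the heads *)

Lemma gram_neq0_rad l (S T : M l) :
  gram S T != 0 -> cell_vec T \notin cell_rad D l.
Proof. by move=> ST; apply/cell_radPn; exists S; rewrite cell_form_vec. Qed.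

Lemma cell_head_act_neq0 l a :
  (exists q : cell_head D l, act a q != 0) <->
  (exists x, cell_act a x \notin cell_rad D l).
Proof.
have aE (x : cell_module D l) :
    (act a (vpi (cell_rad D l) x : cell_head D l) != 0) =
    (cell_act a x \notin cell_rad D l).
  rewrite /= (quot_act_vpi (@cell_rad_submodule _ _ _ D l)).
  by rewrite -(linear0 (vpi (cell_rad D l))) vpi_eq subr0.
split=> [[q aq]|[x ax]]; last by exists (vpi _ x); rewrite aE.
by exists (repr q); rewrite -aE vpi_repr.
Qed.

Lemma cell_head_simple l : cell_form_nonzero D l -> simple_module (cell_head D l).
Proof.
move=> /cell_form_nonzeroP[S [T ST]]; apply: simple_quot_module; last first.
  exact: cell_submodule_full.
(* [C T S] multiplies m_T by Phi(m_S, m_T), which is nonzero, and m_T lies outside the radical. *)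
exists (C T S), (cell_vec T : cell_space D l).
by rewrite /= cell_act_cell rpredZeq cell_form_vec (negPf ST); apply: gram_neq0_rad ST.
Qed.

(** * Heads of distinct cells are not isomorphic *)

(** The involution turns the scalar into the coefficient of [C Q P] in [C Q Q ** C T S], a product
    that involves only cells below [l] in the order of [cd_eps S], or [l] itself. *)
Lemma cd_r_cell_le l m (S T : M l) (P Q : M m) :
  r (C S T) P Q != 0 -> le (cd_eps S) m l.
Proof.
apply: contraNT => nle; apply/eqP; apply: coef_uniq (coef_mulC Q P Q _) _.
rewrite -(cd_starK D (C S T ** _)); apply: coef_star.
rewrite cd_starM !cd_starC; have [y ylt ->] := cd_mulC T S (C Q Q).
apply: (@coef_span _ _ _ _ (fun n => le (cd_eps S) n l)) => //.
apply: spanD.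
  by apply: span_sum => T'; apply: spanZ; apply: spanC; apply: cd_le_refl.
by apply: span_sub (span_idem _ ylt) => n /andP[].
Qed.

Lemma gram_neq0_le l m (S T : M l) :
  isomorphic_modules (cell_head D l) (cell_head D m) -> gram S T != 0 ->
  le (cd_eps S) m l.
Proof.
move=> lm ST.
have /(isomorphic_act_neq0 _ lm)/cell_head_act_neq0[x ax] :
    exists q : cell_head D l, act (C S T) q != 0.
  apply/cell_head_act_neq0; exists (cell_vec S).
  rewrite cell_act_cell rpredZeq cell_form_vec gramC (negPf ST).
  by apply: (@gram_neq0_rad _ T); rewrite gramC.
have /existsP[P /existsP[Q rPQ]] : 
    [exists P : M m, exists Q : M m, r (C S T) P Q != 0].
  apply: contraR ax => /existsPn r0.
  rewrite (_ : cell_act _ _ = 0) ?mem0v //; apply/ffunP=> P; rewrite !ffunE.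
  apply: big1 => Q _; have /existsPn/(_ Q)/negPn/eqP -> := r0 P.
  by rewrite mul0r.
exact: cd_r_cell_le rPQ.
Qed.

Lemma cell_head_inj l m :
  cell_form_nonzero D l ->
  isomorphic_modules (cell_head D l) (cell_head D m) -> l = m.
Proof.
move=> /cell_form_nonzeroP[S [T ST]] lm.
have /(isomorphic_act_neq0 _ lm)/cell_head_act_neq0[x ex] :
    exists q : cell_head D l, act (idem (cd_eps T)) q != 0.
  apply/cell_head_act_neq0; exists (cell_vec T).
  by rewrite cell_act_idem eqxx; apply: gram_neq0_rad ST.
(* The idempotent projects Delta(m) onto the span of the m_P with [cd_eps P = cd_eps T]; its image
   leaves rad(m), so one of these m_P does too. *)
have /existsP[P /andP[/eqP eP Prad]] :
    [exists P : M m, (cd_eps P == cd_eps T) && (cell_vec P \notin cell_rad D m)].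
  apply: contraR ex => /existsPn e0; rewrite (cell_vec_sum x).
  rewrite -[cell_act _ _]/(cell_act_bil D m _ _) linear_sumr.
  apply: memv_suml => P _; rewrite linearZr_LR /= cell_act_idem.
  apply: memvZ; case: ifP => [eP|_]; last by apply: mem0v.
  by have := e0 P; rewrite eP /= negbK.
have [Q QP] := cell_radPn _ Prad; rewrite cell_form_vec in QP.
apply: (@cd_le_anti _ _ _ D (cd_eps T)); apply/andP; split.
  (* The form is symmetric, so [P] can be put first; both inequalities then use the order of
     [cd_eps T]. *)
  rewrite -eP gramC in QP *.
  exact: gram_neq0_le (isomorphic_modules_sym lm) QP.
by apply: (gram_neq0_le (T := S) lm); rewrite gramC.
Qed.

(** * Homomorphisms from a cell module to a given module *)

Lemma cell_act_span_eq0 (V : amodule A) (v : V) (Y : pred X) x :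
  (forall m (S T : M m), Y m -> act (C S T) v = 0) -> span Y x -> act x v = 0.
Proof.
move=> Y0 [s [sP ->]]; rewrite linear_sumlz big_seq big1 // => p.
move=> /sP[m [S [T [Ym ->]]]].
by rewrite linearZl_LR /= Y0 ?scaler0.
Qed.

Section CellHom.
Variables (V : amodule A) (v : V) (l : X) (T : M l).
(** Only [Q] with the idempotent of [T] matter, as the lower terms in [a ** C S T] are multiplied by
    it on the right. *)
Hypothesis Tmin : forall m (P Q : M m), m != l -> le (cd_eps T) m l ->
  cd_eps Q = cd_eps T -> act (C P Q) v = 0.

Definition cell_hom (x : cell_space D l) : V := \sum_S x S *: act (C S T) v.

Fact cell_hom_linear : linear cell_hom.
Proof.
move=> k x y; rewrite /cell_hom scaler_sumr -big_split; apply: eq_bigr => S _.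
by rewrite !ffunE scalerDl /= scalerA.
Qed.
HB.instance Definition _ :=
  GRing.isLinear.Build K (cell_space D l) V _ cell_hom cell_hom_linear.

Lemma cell_hom_vec S : cell_hom (cell_vec S) = act (C S T) v.
Proof.
rewrite /cell_hom (bigD1 S) //= ffunE eqxx scale1r big1 ?addr0 // => U /negPf US.
by rewrite ffunE US scale0r.
Qed.

Lemma cell_hom_act a x : cell_hom (cell_act a x) = act a (cell_hom x).
Proof.
rewrite /cell_hom linear_sumr /=.
under eq_bigr do rewrite ffunE scaler_suml.
rewrite exchange_big; apply: eq_bigr => S _ /=.
rewrite linearZr_LR /= -actM; have [y ylt ->] := cd_mulC S T a.
rewrite linearDl linear_sumlz /= actM.
rewrite (cell_act_span_eq0 (v := act (idem _) v) _ ylt) => [|m P Q /andP[ml lem]].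
  rewrite addr0 scaler_sumr; apply: eq_bigr => S' _.
  by rewrite linearZl_LR /= scalerA mulrC.
rewrite -actM mulC_idem; case: eqP => [eQ|_]; last by rewrite linear0l.
exact: Tmin.
Qed.

Lemma cell_hom_cell U S x :
  act (C U S) (cell_hom x) = cell_form (cell_vec S) x *: act (C U T) v.
Proof. by rewrite -cell_hom_act cell_act_cell linearZ /= cell_hom_vec. Qed.

Lemma simple_cell_head S : simple_module V -> act (C S T) v != 0 ->
  cell_form_nonzero D l /\ isomorphic_modules V (cell_head D l).
Proof.
move=> [_ simV] STv; pose f := linfun cell_hom.
have fM a x : f (act (a : A) (x : cell_module D l)) = act a (f x).
  by rewrite !lfunE /= cell_hom_act.
have fS : f (cell_vec S) != 0 by rewrite lfunE /= cell_hom_vec.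
have fim : limg f = fullv.
  have [|f0|//] := simV (limg f).
    by move=> a _ /memv_imgP[x _ ->]; rewrite -fM memv_img ?memvf.
  by have := memv_img f (memvf (cell_vec S)); rewrite f0 memv0 (negPf fS).
have [x vE] : exists x, v = cell_hom x.
  have /memv_imgP[x _ ->] : v \in limg f by rewrite fim memvf.
  by exists x; rewrite lfunE.
have form_neq0 : cell_form_nonzero D l.
  (* Applying [C S T] to [v = cell_hom x] gives Phi(m_T, x) times [C S T] applied to [v]. *)
  exists (cell_vec T), x; apply: contraNneq STv => Tx.
  by rewrite vE cell_hom_cell Tx scale0r.
split=> //; apply: (hom_quot_isomorphic _ fM fim).
have sker : submodule (lker f : {vspace cell_module D l}).
  by move=> a y; rewrite !memv_ker fM => /eqP ->; rewrite linear0r.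
have kerrad : (lker f <= cell_rad D l)%VS.
  apply: contraNT fS => /(cell_submodule_full sker) kf.
  by rewrite -memv_ker kf memvf.
apply/eqP; rewrite eqEsubv kerrad /=.
(* The image of the radical is 0 or [V]; if it were [V], then [v] would come from some [y] in the
   radical and [C S T] would kill [v]. *)
have [|i0|ifull] := simV (f @: cell_rad D l)%VS.
- move=> a _ /memv_imgP[y yrad ->]; rewrite -fM memv_img //.
  exact: cell_rad_submodule.
- by apply/subvP=> y yrad; rewrite memv_ker -memv0 -i0 memv_img.
have [x0 [y0]] := form_neq0.
have /memv_imgP[y yrad vy] : v \in (f @: cell_rad D l)%VS by rewrite ifull memvf.
case/eqP: STv; rewrite vy lfunE /= cell_hom_cell cell_formC.
by have /cell_radP -> := yrad; rewrite scale0r.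
Qed.

End CellHom.
End CellModules.

(** * Every simple module is a head *)

Lemma simple_isomorphic_cell_head (K : fieldType) (A : nuAlgebra K)
    (X : finType) (D : cell_datum A X) (V : amodule A) :
  simple_module V ->
  exists2 l : X, cell_form_nonzero D l & isomorphic_modules V (cell_head D l).
Proof.
move=> simV; have [[a [v av]] _] := simV.
pose nz e l := [exists S : cd_M D l, exists T : cd_M D l,
  (cd_eps T == e) && (act (cd_C S T) v != 0)].
have [/existsP[l0 /existsP[S0 /existsP[T0 nz0]]]|] := boolP
    [exists l, exists S : cd_M D l, exists T : cd_M D l, act (cd_C S T) v != 0].
  pose e := cd_eps T0.
  have nzl0 : nz e l0.
    by apply/existsP; exists S0; apply/existsP; exists T0; rewrite eqxx.
  (* A cell with the fewest cells below it is minimal for the order, since a strictly smaller cell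
     has a strictly smaller down-set. *)
  case: (arg_minnP (fun l => #|[pred m | cd_le e m l]|) nzl0) => l.
  move=> /existsP[S /existsP[T /andP[/eqP eT STv]]] lmin.
  have [|nzl iso] := simple_cell_head _ simV STv; last by exists l.
  move=> m P Q ml lem eQ; apply/eqP; apply: contraTT isT => PQv.
  have /lmin : nz e m.
    apply/existsP; exists P; apply/existsP; exists Q.
    by rewrite eQ eT eqxx.
  rewrite leqNgt => /negP; case; apply: proper_card; rewrite eT in lem.
  apply/properP; split.
    by apply/subsetP=> n; rewrite !inE => /cd_le_trans; apply.
  exists l; rewrite !inE ?cd_le_refl //; apply: contra ml => lel.
  by apply/eqP; apply: (@cd_le_anti _ _ _ D e); rewrite lem.
(* If every basis element kills [v], then so does [a], contrary to the choice of [v]. *)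
move=> /existsPn v0; case/eqP: av.
apply: (cell_act_span_eq0 (D := D) _ (spanT D a)) => m S T _.
have /existsPn/(_ S)/existsPn/(_ T) := v0 m.
by rewrite negbK => /eqP.
Qed.

Theorem theorem3p17 (K : fieldType) (R : nuAlgebra K) (X : finType)
    (D : cell_datum R X) :
  (forall l : X, cell_form_nonzero D l -> simple_module (cell_head D l)) /\
  (forall V : amodule R, simple_module V ->
     exists2 l : X, cell_form_nonzero D l &
       isomorphic_modules V (cell_head D l)) /\
  (forall l m : X, cell_form_nonzero D l -> cell_form_nonzero D m ->
     isomorphic_modules (cell_head D l) (cell_head D m) -> l = m).
Proof.
split; first exact: cell_head_simple.
split=> [V|l m l0 _]; [exact: simple_isomorphic_cell_head | exact: cell_head_inj].
Qed.
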